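(* Let $Q\in\mathbb{R}^{n\times n}$ be symmetric positive definite, let $r\in\mathbb{R}^n$ be fixed, and let $y$, $s=x(y)$, $a=r-s$, $x_z$ and $E_r$ be as defined in the context. Then for every $z\in\{0,1\}^n$, $$E_r(z)=E_r(0)+W_r(z),$$ where $W_r:\{0,1\}^n\to\mathbb{R}$ is the quadratic pseudo-Boolean function $$W_r(z)=\sum_{i=1}^n\alpha_i z_i+\sum_{1\le i<j\le n}\beta_{ij}z_iz_j$$ with coefficients $$\alpha_i=2s_i(Qa)_i+2Q_{ii}\quad(1\le i\le n),\qquad \beta_{ij}=4s_is_jQ_{ij}\quad(1\le i<j\le n).$$
   Context: Binary vectors are row vectors; real vectors are column vectors. For $c\in\{0,1\}^n$, $x(c)=(1-2c_1,\ldots,1-2c_n)^{\mathsf T}\in\{-1,+1\}^n$. The matrix $Q=\Sigma^{-1}$ is the precision matrix of a symmetric positive-definite covariance $\Sigma\in\mathbb{R}^{n\times n}$. For $r\in\mathbb{R}^n$, the hard-decision word $y\in\{0,1\}^n$ is $y_i=0$ if $r_i\ge 0$ and $y_i=1$ otherwise; $s=x(y)$ and $a=r-s$. For $z\in\{0,1\}^n$, $x_z=x(y\oplus z)$, where $\oplus$ is componentwise addition over $\mathbb{F}_2$ (equivalently $x_z=s\odot(\mathbf{1}_n-2z^{\mathsf T})$ with $\odot$ the entrywise product), and $$E_r(z)=\tfrac12(r-x_z)^{\mathsf T}Q(r-x_z).$$ $E_r(0)$ denotes the value at the all-zero vector. *)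

(* Defs.v *)
From mathcomp Require Import all_boot all_order all_algebra.
From mathcomp Require Import reals.

Set Implicit Arguments.
Unset Strict Implicit.
Unset Printing Implicit Defensive.

Import Order.TTheory GRing.Theory Num.Theory.
Local Open Scope ring_scope.

Definition posdefmx (R : realType) (n : nat) (Q : 'M[R]_n) : Prop :=
  Q \is symmetricmx /\
  forall v : 'cV[R]_n, v != 0 -> 0 < (v^T *m Q *m v) 0 0.

(* Binary words are row vectors over 'F_2, so that the componentwise addition
   of words modulo 2 is the addition of 'rV['F_2]_n; [bitr R b] is the bit [b]
   read as the real number 0 or 1 (this is not a ring morphism). *)
Definition bitr (R : realType) (b : 'F_2) : R := (nat_of_ord b)%:R.

Section Energy.
Variables (R : realType) (n : nat).

Definition bipolar (c : 'rV['F_2]_n) : 'cV[R]_n :=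
  \col_i (1 - 2 * bitr R (c 0 i)).

Variables (Q : 'M[R]_n) (r : 'cV[R]_n).

Definition hard_decision : 'rV['F_2]_n :=
  \row_i (if 0 <= r i 0 then 0 else 1).

Definition hard_sign : 'cV[R]_n := bipolar hard_decision.

Definition residual : 'cV[R]_n := r - hard_sign.

(* The bipolar image of the hard decision with the bits marked by [z] flipped. *)
Definition candidate (z : 'rV['F_2]_n) : 'cV[R]_n :=
  bipolar (hard_decision + z).

Definition energy (z : 'rV['F_2]_n) : R :=
  2^-1 * ((r - candidate z)^T *m Q *m (r - candidate z)) 0 0.

Definition lin_coef (i : 'I_n) : R :=
  2 * hard_sign i 0 * (Q *m residual) i 0 + 2 * Q i i.

Definition quad_coef (i j : 'I_n) : R :=
  4 * hard_sign i 0 * hard_sign j 0 * Q i j.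

Definition flip_weight (z : 'rV['F_2]_n) : R :=
  \sum_(i < n) lin_coef i * bitr R (z 0 i) +
  \sum_(i < n) \sum_(j < n | (i < j)%N)
     quad_coef i j * bitr R (z 0 i) * bitr R (z 0 j).

End Energy.

(* Main.v *)
Require Import Defs.
From mathcomp Require Import all_boot all_order all_algebra.
From mathcomp Require Import reals.
From mathcomp Require Import ring.

Import GRing.Theory Num.Theory.
Local Open Scope ring_scope.

(** Flipping the bits in [z] moves the residual [a] to [a + d], where
    [d_i = 2 s_i z_i]. In the expansion of the quadratic form at [a + d] the
    cross term gives the linear coefficients, and the diagonal of [d^T Q d]
    joins them because [s_i ^ 2 = 1] and [z_i ^ 2 = z_i]. *)

Lemma sum_sym_offdiag (V : nmodType) (n : nat) (F : 'I_n -> 'I_n -> V)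
    (symF : forall i j, F i j = F j i) :
  \sum_i \sum_j F i j =
  \sum_i F i i + (\sum_(i < n) \sum_(j < n | (i < j)%N) F i j) *+ 2.
Proof.
have -> : \sum_i \sum_j F i j =
    \sum_i (F i i + (\sum_(j < n | (i < j)%N) F i j +
                     \sum_(j < n | (j < i)%N) F i j)).
  apply: eq_bigr => i _; rewrite (bigD1 i) //=; congr (_ + _).
  (* By trichotomy, the indices [j != i] outside [i < j] are those with [j < i]. *)
  rewrite (bigID (fun j : 'I_n => (i < j)%N)) /=; congr (_ + _);
    apply: eq_bigl => j; rewrite -(inj_eq val_inj) /=; by case: ltngtP.
rewrite !big_split /= mulr2n; congr (_ + (_ + _)).
(* Exchanging the summations carries the lower triangle to the upper one, where [symF] identifies
   the terms. *)
rewrite (exchange_big_dep predT) //=.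
by apply: eq_bigr => i _; apply: eq_bigr => j _.
Qed.

(** The two cross terms are transposes of each other as 1 x 1 matrices, since [Q] is symmetric, so
    they merge into a double. *)
Lemma quad_form_add (R : comPzRingType) (n : nat) (Q : 'M[R]_n)
    (symQ : Q^T = Q) (a d : 'cV[R]_n) :
  ((a + d)^T *m Q *m (a + d)) 0 0 =
  (a^T *m Q *m a) 0 0 + (d^T *m Q *m a) 0 0 *+ 2 + (d^T *m Q *m d) 0 0.
Proof.
have cross : (a^T *m Q *m d) 0 0 = (d^T *m Q *m a) 0 0.
  transitivity ((a^T *m Q *m d)^T 0 0); first by rewrite [RHS]mxE.
  by rewrite !trmx_mul trmxK symQ mulmxA.
have mxD00 (A B : 'M[R]_1) : (A + B) 0 0 = A 0 0 + B 0 0 by rewrite mxE.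
by rewrite [(a + d)^T]raddfD /= !mulmxDl !mulmxDr !mxD00 cross; ring.
Qed.

Lemma quad_form_sum (R : comPzRingType) (n : nat) (Q : 'M[R]_n) (d : 'cV[R]_n) :
  (d^T *m Q *m d) 0 0 = \sum_i \sum_j d i 0 * d j 0 * Q i j.
Proof.
rewrite -mulmxA mxE; apply: eq_bigr => i _; rewrite !mxE mulr_sumr.
by apply: eq_bigr => j _; ring.
Qed.

Lemma F2_cases (b : 'F_2) : b = 0 \/ b = 1.
Proof. by case: b => -[|[|//]] lt_b; [left | right]; apply: val_inj. Qed.

Lemma bitr0 (R : realType) : bitr R 0 = 0. Proof. by []. Qed.

Lemma bitr1 (R : realType) : bitr R 1 = 1. Proof. by []. Qed.

Lemma F2_add11 : 1 + 1 = 0 :> 'F_2. Proof. exact: val_inj. Qed.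

Lemma bitr_idem (R : realType) (b : 'F_2) : bitr R b * bitr R b = bitr R b.
Proof. by case: (F2_cases b) => ->; rewrite ?bitr0 ?bitr1 ?mulr0 ?mulr1. Qed.

(** [bitr] is not additive, but [b |-> 1 - 2 * bitr R b] is the sign character of ['F_2], which
    turns sums into products; the four cases check this. *)
Lemma bipolarD (R : realType) (n : nat) (c z : 'rV['F_2]_n) (i : 'I_n) :
  bipolar R (c + z) i 0 = bipolar R c i 0 * (1 - 2 * bitr R (z 0 i)).
Proof.
rewrite !mxE.
by case: (F2_cases (c 0 i)) => ->; case: (F2_cases (z 0 i)) => ->;
  rewrite ?addr0 ?add0r ?F2_add11 ?bitr0 ?bitr1; ring.
Qed.

Lemma bipolar_sqr (R : realType) (n : nat) (c : 'rV['F_2]_n) (i : 'I_n) :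
  bipolar R c i 0 * bipolar R c i 0 = 1.
Proof. by rewrite !mxE; case: (F2_cases (c 0 i)) => ->; rewrite ?bitr0 ?bitr1; ring. Qed.

Lemma residual_flip (R : realType) (n : nat) (r : 'cV[R]_n) (z : 'rV['F_2]_n) :
  r - candidate r z =
  residual r + \col_i (2 * hard_sign r i 0 * bitr R (z 0 i)).
Proof.
apply/colP => i.
have subE (u v : 'cV[R]_n) : (u - v) i 0 = u i 0 - v i 0 by rewrite !mxE.
rewrite [RHS]mxE /residual !subE bipolarD !mxE; ring.
Qed.

Theorem mainTheorem1 (R : realType) (n : nat) (Q : 'M[R]_n) (r : 'cV[R]_n)
    (hQ : posdefmx Q) (z : 'rV['F_2]_n) :
  energy Q r z = energy Q r 0 + flip_weight Q r z.
Proof.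
case: hQ => symQ _.
have trQ : Q^T = Q.
  (* A symmetric matrix is encoded as a Hermitian one with sign [(-1) ^+ 0] and the identity as
     conjugation. *)
  by move/is_hermitianmxP: symQ => {2}->; rewrite expr0 scale1r map_mx_id.
have res0 : r - candidate r 0 = residual r by rewrite /candidate addr0.
rewrite /energy res0 residual_flip quad_form_add // -addrA mulrDr.
congr (_ + _).
set d := (X in X^T *m Q *m residual r).
have dE i : d i 0 = 2 * hard_sign r i 0 * bitr R (z 0 i) by rewrite [LHS]mxE.
rewrite quad_form_sum sum_sym_offdiag; last first.
  by move=> i j; rewrite [d i 0 * _]mulrC -{1}trQ [Q^T _ _]mxE.
rewrite /flip_weight addrA mulrDr; congr (_ + _).
  rewrite -mulmxA mxE -sumrMnl -big_split mulr_sumr; apply: eq_bigr => i _ /=.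
  rewrite [d^T 0 i]mxE dE /lin_coef.
  have /= ss := bipolar_sqr R n (hard_decision r) i; rewrite -/(hard_sign r) in ss.
  have bb := bitr_idem R (z 0 i).
  set s := hard_sign r i 0 in ss *; set b := bitr R _ in bb *.
  (* Isolating the squares lets [ss] and [bb] make the diagonal term linear in [b]. *)
  have -> : 2 * s * b * (2 * s * b) * Q i i = 4 * Q i i * (s * s) * (b * b) by ring.
  by rewrite ss bb; field.
(* The factor 1/2 of the energy cancels the doubling of the upper triangle; the 4 in [quad_coef]
   comes from the 2 in each of [d i 0] and [d j 0]. *)
rewrite -[X in _ * X = _]mulr_natl mulKf ?pnatr_eq0 //.
apply: eq_bigr => i _; apply: eq_bigr => j _.
by rewrite !dE /quad_coef; ring.
Qed.
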